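(* The Killing-max property holds for the root systems $B_n$ and $C_n$: for all $\lambda,Y\in\overline{\mathfrak a^+}$ and all $w\in W$, $$\langle\lambda,w\cdot Y\rangle=\langle\lambda,Y\rangle\iff w\in W_\lambda\,W_Y .$$
   Context: For the root systems $B_n$ and $C_n$: $\mathfrak a=\mathbb R^n$, $W=S_n\rtimes\{\pm1\}^n$ acts by permuting the entries and changing any number of signs, $\overline{\mathfrak a^+}=\{x\in\mathbb R^n:x_1\ge x_2\ge\dots\ge x_n\ge0\}$ is the closed positive Weyl chamber, and $\langle\cdot,\cdot\rangle$ is the $W$-invariant scalar product (the Killing form, a positive multiple of the standard scalar product). For $X\in\mathfrak a$, $W_X=\{w\in W:w\cdot X=X\}$; $W_\lambda W_Y=\{uv:u\in W_\lambda,v\in W_Y\}$. *)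

(* Defs.v *)
From HB Require Import structures.
From mathcomp Require Import all_boot all_order all_algebra all_fingroup.
From mathcomp Require Import reals.

Set Implicit Arguments.
Unset Strict Implicit.
Unset Printing Implicit Defensive.

Import Order.TTheory GRing.Theory Num.Theory.
Local Open Scope ring_scope.

(* The Weyl group S_n |>< {+1,-1}^n of B_n and C_n.  The pair (s, e) stands for
   "permute the entries by s, then change the sign of entry i iff e i". *)
Definition weyl (n : nat) : Type := ('S_n * {ffun 'I_n -> bool})%type.

HB.instance Definition _ (n : nat) := Finite.on (weyl n).

(* Composition of signed permutations, v being applied first; the order of the
   factors is reversed in 'S_n because (s * t)%g maps i to t (s i). *)
Definition weyl_mul (n : nat) (u v : weyl n) : weyl n :=
  ((v.1 * u.1)%g, [ffun i => u.2 i (+) v.2 ((u.1^-1)%g i)]).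

Definition weyl_one (n : nat) : weyl n := (1%g, [ffun=> false]).

Definition weyl_inv (n : nat) (u : weyl n) : weyl n :=
  ((u.1^-1)%g, [ffun i => u.2 (u.1 i)]).

Lemma weyl_mulA (n : nat) : associative (@weyl_mul n).
Proof.
move=> u v w; congr pair; rewrite /= ?mulgA //.
by apply/ffunP=> i; rewrite !ffunE /= invMg permM addbA.
Qed.

Lemma weyl_mul1 (n : nat) : left_id (weyl_one n) (@weyl_mul n).
Proof.
case=> s e; congr pair; rewrite /= ?mulg1 //.
by apply/ffunP=> i; rewrite !ffunE /= invg1 perm1.
Qed.

Lemma weyl_mulV (n : nat) : left_inverse (weyl_one n) (@weyl_inv n) (@weyl_mul n).
Proof.
case=> s e; congr pair; rewrite /= ?mulgV //.
by apply/ffunP=> i; rewrite !ffunE /= invgK addbb.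
Qed.

HB.instance Definition _ (n : nat) :=
  Finite_isGroup.Build (weyl n) (@weyl_mulA n) (@weyl_mul1 n) (@weyl_mulV n).

Definition weyl_act (R : realType) (n : nat) (w : weyl n) (x : 'rV[R]_n) : 'rV[R]_n :=
  \row_i ((-1) ^+ w.2 i * x 0 ((w.1^-1)%g i)).

Lemma weyl_act1 (R : realType) (n : nat) (x : 'rV[R]_n) :
  weyl_act (1%g : weyl n) x = x.
Proof. by apply/rowP=> i; rewrite mxE /= ffunE invg1 perm1 mul1r. Qed.

Lemma weyl_actM (R : realType) (n : nat) (u v : weyl n) (x : 'rV[R]_n) :
  weyl_act (u * v)%g x = weyl_act u (weyl_act v x).
Proof.
by apply/rowP=> i; rewrite !mxE /= ffunE invMg permM signr_addb mulrA.
Qed.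

Definition weyl_stab (R : realType) (n : nat) (x : 'rV[R]_n) : {set weyl n} :=
  [set w | weyl_act w x == x].

Definition closed_chamber (R : realType) (n : nat) (x : 'rV[R]_n) : Prop :=
  (forall i j : 'I_n, (i <= j)%N -> x 0 j <= x 0 i) /\ (forall i, 0 <= x 0 i).

(* The Killing form restricted to R^n: c times the standard scalar product,
   where the constant c > 0 depends on the root multiplicities. *)
Definition killing (R : realType) (n : nat) (c : R) (x y : 'rV[R]_n) : R :=
  c * \sum_i x 0 i * y 0 i.

Lemma killing_weyl_act (R : realType) (n : nat) (c : R) (w : weyl n) (x y : 'rV[R]_n) :
  killing c (weyl_act w x) (weyl_act w y) = killing c x y.
Proof.
congr (c * _); rewrite [RHS](reindex_inj (@perm_inj _ (w.1^-1)%g)).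
by apply: eq_bigr => i _; rewrite !mxE mulrACA -expr2 sqrr_sign mul1r.
Qed.

(* Main.v *)
Require Import Defs.
From mathcomp Require Import all_boot all_order all_algebra all_fingroup.
From mathcomp Require Import reals ring.

Set Implicit Arguments.
Unset Strict Implicit.
Unset Printing Implicit Defensive.

Import Order.TTheory GRing.Theory Num.Theory.
Local Open Scope ring_scope.

(** Let Z be a point of the orbit W Y at which <lambda, .> is maximal, and let
    uZ, with u in W_lambda, maximise <rho, .> for a fixed regular dominant rho.
    If uZ were not dominant, reflecting it in a violated wall would not decrease
    <lambda, .>; by maximality the reflection then fixes lambda, yet it strictly
    increases <rho, .>, a contradiction.  As Y is the only dominant point of its
    orbit, uZ = Y.  For one maximiser Z this shows that the maximum of
    <lambda, .> on W Y is <lambda, Y>; for Z = wY it then gives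
    w = u^-1 (u w) with u w in W_Y. *)

(** Reflection in the hyperplane x_i = x_j; [weyl_flip] is the one in x_i = 0. Any failure of
    dominance is detected by one of these two kinds. *)
Definition weyl_swap (n : nat) (i j : 'I_n) : weyl n := (tperm i j, [ffun=> false]).

Definition weyl_flip (n : nat) (i : 'I_n) : weyl n := (1%g, [ffun k => k == i]).

Section WeylChamber.

Variables (R : realType) (n : nat).
Implicit Types (x y z a : 'rV[R]_n) (i j : 'I_n) (u w : weyl n).

Lemma weyl_act_swapE i j x k : weyl_act (weyl_swap i j) x 0 k = x 0 (tperm i j k).
Proof. by rewrite mxE /= ffunE expr0 mul1r tpermV. Qed.

Lemma weyl_act_flipE i x k :
  weyl_act (weyl_flip i) x 0 k = if k == i then - x 0 k else x 0 k.
Proof.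
rewrite mxE /= ffunE invg1 perm1.
by case: (k == i); rewrite ?expr0 ?expr1 ?mul1r ?mulN1r.
Qed.

Lemma killing_swap c i j a x : i != j ->
  killing c a (weyl_act (weyl_swap i j) x) =
  killing c a x + c * ((a 0 i - a 0 j) * (x 0 j - x 0 i)).
Proof.
move=> ij; rewrite /killing -mulrDr; congr (c * _).
rewrite (bigD1 i) // (bigD1 j) 1?eq_sym //= !weyl_act_swapE tpermL tpermR.
rewrite [in RHS](bigD1 i) // [in RHS](bigD1 j) 1?eq_sym //=.
rewrite (eq_bigr (fun k => a 0 k * x 0 k)); first by ring.
by move=> k /andP[ki kj]; rewrite weyl_act_swapE tpermD // eq_sym.
Qed.

Lemma killing_flip c i a x :
  killing c a (weyl_act (weyl_flip i) x) =
  killing c a x - c * (a 0 i * x 0 i) *+ 2.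
Proof.
rewrite /killing (bigD1 i) // [in RHS](bigD1 i) //= weyl_act_flipE eqxx.
rewrite (eq_bigr (fun k => a 0 k * x 0 k)); first by ring.
by move=> k ki; rewrite weyl_act_flipE (negbTE ki).
Qed.

Lemma weyl_swap_stab i j a : a 0 i = a 0 j -> weyl_swap i j \in weyl_stab a.
Proof.
move=> aij; rewrite inE; apply/eqP/rowP => k; rewrite weyl_act_swapE.
by case: tpermP => [->|->|].
Qed.

Lemma weyl_flip_stab i a : a 0 i = 0 -> weyl_flip i \in weyl_stab a.
Proof.
move=> ai; rewrite inE; apply/eqP/rowP => k; rewrite weyl_act_flipE.
by case: eqP => // ->; rewrite ai oppr0.
Qed.

Lemma weyl_stab1 a : 1%g \in weyl_stab a.
Proof. by rewrite inE weyl_act1. Qed.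

Lemma weyl_stabM a u w :
  u \in weyl_stab a -> w \in weyl_stab a -> (u * w)%g \in weyl_stab a.
Proof. by rewrite !inE weyl_actM => /eqP ua /eqP ->; rewrite ua. Qed.

Lemma weyl_stabV a u : u \in weyl_stab a -> (u^-1)%g \in weyl_stab a.
Proof. by rewrite !inE => /eqP {1}<-; rewrite -weyl_actM mulVg weyl_act1. Qed.

(** Writing a as u a in the first argument reduces this to W-invariance. *)
Lemma killing_stab c a u x :
  u \in weyl_stab a -> killing c a (weyl_act u x) = killing c a x.
Proof. by rewrite inE => /eqP {1}<-; rewrite killing_weyl_act. Qed.

Lemma chamber_sorted x : closed_chamber x ->
  sorted (>=%O : rel R) [seq x 0 i | i <- enum 'I_n].
Proof.
case=> x_mono _; rewrite sorted_map.
apply: (@sub_sorted _ (relpre val ltn)) => [i j /ltnW|]; first exact: x_mono.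
by rewrite -sorted_map val_enum_ord iota_ltn_sorted.
Qed.

Lemma chamber_orbit_uniq x w :
  closed_chamber x -> closed_chamber (weyl_act w x) -> weyl_act w x = x.
Proof.
move=> cx cwx.
have wxE i : weyl_act w x 0 i = x 0 ((w.1^-1)%g i).
  (* Both entries are non-negative, so absolute values remove the sign. *)
  have wx_ge0 := cwx.2 i; rewrite -[LHS]ger0_norm // mxE normrM normr_sign mul1r.
  exact/ger0_norm/cx.2.
(* Two decreasing lists with the same multiset of entries coincide. *)
have eq_s : [seq weyl_act w x 0 i | i <- enum 'I_n] = [seq x 0 i | i <- enum 'I_n].
  apply: (sorted_eq ge_trans ge_anti); try exact: chamber_sorted.
  rewrite (eq_map wxE) (map_comp (x 0)); apply/perm_map/uniq_perm.
  - by rewrite map_inj_uniq ?enum_uniq //; apply: perm_inj.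
  - exact: enum_uniq.
  move=> i; rewrite mem_enum; apply/mapP.
  by exists (w.1 i); rewrite ?mem_enum ?permK.
apply/rowP => i; move/eq_in_map: eq_s; apply.
by rewrite mem_enum.
Qed.

(** Half the sum of the positive roots of C_n: as indices start at 0, this is (n, ..., 2, 1), which
    lies on no wall. *)
Definition weyl_rho : 'rV[R]_n := \row_i (n - i)%:R.

Lemma weyl_rho_gt0 i : 0 < weyl_rho 0 i.
Proof. by rewrite mxE ltr0n subn_gt0. Qed.

Lemma weyl_rho_anti i j : (i < j)%N -> weyl_rho 0 j < weyl_rho 0 i.
Proof. by move=> ij; rewrite !mxE ltr_nat ltn_sub2l. Qed.

Lemma chamber_of_max c a z : 0 < c -> closed_chamber a ->
  (forall w, killing c a (weyl_act w z) <= killing c a z) ->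
  exists2 u, u \in weyl_stab a & closed_chamber (weyl_act u z).
Proof.
move=> c_gt0 [a_mono a_ge0] z_max.
(* The stabiliser is finite and contains 1, so a maximiser exists. *)
have [u ua u_max] :=
  @arg_maxP _ _ _ _ _ (fun u => killing c weyl_rho (weyl_act u z)) (weyl_stab1 a).
exists u => //; set x := weyl_act u z in u_max *.
have x_max w : killing c a (weyl_act w x) <= killing c a x.
  by rewrite -weyl_actM (killing_stab _ _ ua).
have x_rho w : w \in weyl_stab a ->
    killing c weyl_rho (weyl_act w x) <= killing c weyl_rho x.
  by move=> wa; rewrite -weyl_actM; apply/u_max/weyl_stabM.
split=> [i j|i].
  rewrite leq_eqVlt => /orP[/eqP/val_inj -> //|ij].
  have ij' : i != j by rewrite neq_ltn ij.
  rewrite leNgt; apply/negP => x_ij.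
  (* As x_i < x_j, maximality gives a_i <= a_j, hence equality by dominance of a; the swap thus
     fixes a and may be tested against [weyl_rho]. *)
  have := x_max (weyl_swap i j).
  rewrite killing_swap // gerDl pmulr_rle0 // pmulr_lle0 ?subr_gt0 // subr_le0 => aij.
  have := x_rho _ (weyl_swap_stab (le_anti (introT andP (conj aij (a_mono _ _ (ltnW ij)))))).
  rewrite killing_swap // gerDl pmulr_rle0 // pmulr_lle0 ?subr_gt0 // subr_le0.
  by rewrite leNgt weyl_rho_anti.
rewrite leNgt; apply/negP => x_i.
(* Likewise x_i < 0 forces a_i = 0, so the flip fixes a. *)
have := x_max (weyl_flip i).
rewrite killing_flip gerBl pmulrn_lge0 // pmulr_rge0 // nmulr_lge0 // => ai.
have := x_rho _ (weyl_flip_stab (le_anti (introT andP (conj ai (a_ge0 i))))).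
rewrite killing_flip gerBl pmulrn_lge0 // pmulr_rge0 // nmulr_lge0 //.
by rewrite leNgt weyl_rho_gt0.
Qed.

Lemma killing_chamber_max c a y w : 0 < c ->
  closed_chamber a -> closed_chamber y ->
  killing c a (weyl_act w y) <= killing c a y.
Proof.
move=> c_gt0 ca cy.
have [v _ v_max] :=
  @arg_maxP _ _ _ 1%g predT (fun v => killing c a (weyl_act v y)) isT.
have [u ua] : exists2 u, u \in weyl_stab a & closed_chamber (weyl_act u (weyl_act v y)).
  by apply: (chamber_of_max c_gt0 ca) => u; rewrite -weyl_actM; apply: v_max.
rewrite -weyl_actM => /(chamber_orbit_uniq cy) uvy.
(* Here y = u (v y) with u fixing a, so y attains the same maximum as v y. *)
by rewrite -[in leRHS]uvy weyl_actM (killing_stab _ _ ua); apply: v_max.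
Qed.

End WeylChamber.

Theorem propositionA6 (R : realType) (n : nat) (c : R) (c_gt0 : 0 < c)
    (lambda Y : 'rV[R]_n) (w : weyl n) :
  closed_chamber lambda -> closed_chamber Y ->
  killing c lambda (weyl_act w Y) = killing c lambda Y <->
  w \in (weyl_stab lambda * weyl_stab Y)%g.
Proof.
move=> cl cY; split=> [wY_eq|/mulsgP[u v ul + ->]]; last first.
  by rewrite inE weyl_actM => /eqP ->; apply: killing_stab.
have [u ul] : exists2 u, u \in weyl_stab lambda & closed_chamber (weyl_act u (weyl_act w Y)).
  (* The assumed equality makes w Y a maximiser on its orbit. *)
  apply: (chamber_of_max c_gt0 cl) => u.
  by rewrite wY_eq -weyl_actM killing_chamber_max.
rewrite -weyl_actM => /(chamber_orbit_uniq cY) uwY.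
rewrite -(mulKg u w); apply: mem_mulg; first exact: weyl_stabV.
by rewrite inE uwY.
Qed.
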